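(* Let $q > 1$ be a rational number such that the equation $n^n = q$ has no solution $n \in \mathbb{N}$. Then there exists a transcendental real number $x$ such that $x^x = q$.
   Context: $\mathbb{N}$ denotes the set of positive integers. For a positive real number $x$, $x^x$ denotes the positive real number $\exp(x\log x)$. A real number is transcendental if it is not algebraic over $\mathbb{Q}$. *)

(* Defs.v *)
From mathcomp Require Import all_boot all_order all_algebra.
From mathcomp Require Import all_classical all_reals all_analysis.
Set Implicit Arguments.
Unset Strict Implicit.
Unset Printing Implicit Defensive.
Import Order.TTheory GRing.Theory Num.Theory.
Local Open Scope ring_scope.

Definition transcendental (R : realType) (x : R) : Prop :=
  ~ algebraicOver (ratr : rat -> R) x.

(* Main.v *)
Require Import Defs.
From mathcomp Require Import all_boot all_order all_algebra.
From mathcomp Require Import all_classical all_reals all_analysis.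
From mathcomp Require Import perm ring lra zify.
Set Implicit Arguments.
Unset Strict Implicit.
Unset Printing Implicit Defensive.
Import Order.TTheory GRing.Theory Num.Theory.
Import numFieldNormedType.Exports.
Local Open Scope ring_scope.

(** Since [t * ln t] is continuous, some [x > 1] satisfies [x `^ x = q]. If [x]
    were rational, unique factorization would make it an integer
    ([rational_powR_self]), which the hypothesis on [q] excludes. It remains to
    exclude that [x] is algebraic and irrational. This is an instance of the
    Gelfond-Schneider theorem, with base and exponent both equal to [x]; as they
    are real, Schneider's method goes through with real analysis alone.

    Put [w = ln x] and consider the functions
    [F z = sum of c_st * z ^ s * exp (t w z)], for [s < S], [t < T], with
    integers [c_st]. At the points [i + j x] the function takes the value of
    an integer polynomial at [x], up to a power of the denominator of [q],
    because [exp (w (i + j x)) = x ^ i * q ^ j]. Three facts about [F] conflict.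

    - Not all [F (i + j x)] with [i, j < N] vanish when [N ^ 2 >= S T] and the
      [c_st] are not all zero: by Rolle's theorem an exponential polynomial has
      fewer real zeros than coefficients ([exp_poly_eq0]), and the points are
      distinct because [x] is irrational.
    - The pigeonhole principle gives nonzero [c_st] of moderate size for which
      the first [K] Taylor coefficients of [F] are tiny, where [K] is a small
      fraction of the number [S T] of unknowns; the Taylor remainder is tiny
      too, so [F] is tiny on an interval containing all the points
      ([ex_small_aux_fun]).
    - A nonzero value of an integer polynomial at the algebraic number [x] is
      bounded below in terms of its degree and coefficients
      ([liouville_inequality]), so [F (i + j x)] is either zero or not tiny
      ([aux_fun_liouville]).

    Hence every [F (i + j x)] is zero, contradicting the first fact. The
    parameters for which the two bounds are incompatible are chosen in
    [ex_parameters]. *)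

(** * Real zeros of exponential polynomials *)

(** The zeros of [f'] are produced in increasing order, so that none of them is
    counted twice. *)
Lemma Rolle_path (R : realType) (f f' : R -> R) (a : R) (zs : seq R) :
  (forall x : R, is_derive x (1 : R) f (f' x)) ->
  path <%R a zs -> {in a :: zs, forall z, f z = 0} ->
  exists ws, [/\ path <%R a ws, size ws = size zs &
                 {in ws, forall z, f' z = 0}].
Proof.
move=> df; elim: zs a => [|b zs IH] a /=; first by exists [::].
move=> /andP[ab pzs] f0.
have [ws [pws sws f'0]] : exists ws, [/\ path <%R b ws, size ws = size zs &
    {in ws, forall z, f' z = 0}].
  by apply: IH => // z zin; apply: f0; rewrite inE zin orbT.
have dbl (x : R) : derivable f x (1 : R) by have := df x => /@ex_derive.
have [||c /itvP cab dc] := @Rolle R f a b ab (fun x _ => dbl x).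
- apply: continuous_subspaceT => x.
  exact/differentiable_continuous/derivable1_diffP.
- by rewrite !f0// !inE eqxx ?orbT.
exists (c :: ws); split => /=; first last.
- move=> z; rewrite inE => /predU1P[->|/f'0//].
  by have [_ <-] := df c; have [_ ->] := dc.
- by rewrite sws.
- rewrite cab /=; apply: (path_le lt_trans _ pws).
  by rewrite cab.
Qed.

Definition exp_poly (R : realType) (l : seq (R * {poly R})) (z : R) : R :=
  \sum_(a <- l) a.2.[z] * expR (a.1 * z).

(** The exponential polynomial [(exp (- v z) * F z)'], where [F] is the one
    given by [l]. *)
Definition twisted_deriv (R : realType) (v : R) (l : seq (R * {poly R})) :=
  [seq (a.1 - v, a.2^`() + (a.1 - v) *: a.2) | a <- l].

Lemma is_derive_twisted (R : realType) (v : R) (l : seq (R * {poly R})) (z : R) :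
  is_derive z (1 : R) (fun z => expR (- v * z) * exp_poly l z)
                (exp_poly (twisted_deriv v l) z).
Proof.
rewrite /exp_poly /twisted_deriv big_map.
under eq_fun do rewrite big_distrr /=.
elim: l => [|a l IH].
  by under eq_fun do rewrite big_nil; rewrite big_nil; exact: is_derive_cst.
under eq_fun do rewrite big_cons; rewrite big_cons.
apply: is_deriveD.
have -> : (fun x => expR (- v * x) * (a.2.[x] * expR (a.1 * x))) =
    (horner a.2) * (expR \o ( *%R (a.1 - v))).
  apply/funext => x /=; rewrite !fctE /= mulrCA -expRD; congr (_ * expR _).
  by ring.
have dm : is_derive z (1 : R) ( *%R (a.1 - v)) (a.1 - v).
  have := @is_deriveZ _ _ _ id (a.1 - v) z 1 1 _.
  by rewrite scaler1; apply.
apply: is_derive_eq.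
rewrite !fctE /= hornerD hornerZ mulrDl addrC /GRing.scale /=; ring.
Qed.

Lemma size_deriv_add_scale (R : realType) (p : {poly R}) (c : R) : c != 0 ->
  size (p^`() + c *: p) = size p.
Proof.
move=> c0; have [->|p0] := eqVneq p 0; first by rewrite derivC scaler0 addr0.
by rewrite addrC size_polyDl size_scale// lt_size_deriv.
Qed.

(** Induction on the number of terms plus the number of coefficients. With
    [(v, p)] the first term and [p != 0], passing from [F] to
    [(exp (- v z) * F z)'] lowers the size of [p] by one, keeps the sizes of the
    other polynomials, and by Rolle's theorem loses at most one zero. *)
Lemma exp_poly_eq0 (R : realType) (l : seq (R * {poly R})) (zs : seq R) :
  uniq (unzip1 l) -> sorted <%R zs ->
  (\sum_(a <- l) size a.2 <= size zs)%N ->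
  {in zs, forall z, exp_poly l z = 0} -> forall a, a \in l -> a.2 = 0.
Proof.
have [n] := ubnP (size l + \sum_(a <- l) size a.2)%N.
elim: n l zs => // n IH [|[v p] l] zs //=.
rewrite !big_cons /= ltnS => len /andP[vl ul] szs lez F0 a.
have [p0|p0] := eqVneq p 0.
  rewrite inE => /predU1P[->//|]; apply: (IH l zs) => //.
  - by move: len; rewrite p0 size_poly0 add0n addSn.
  - by move: lez; rewrite p0 size_poly0.
  - by move=> z /F0; rewrite /exp_poly big_cons /= p0 horner0 mul0r add0r.
have sp : (0 < size p)%N by rewrite size_poly_gt0.
case: zs szs lez F0 => [|z0 zs] /= szs lez F0.
  by move: lez; rewrite leqn0 addn_eq0 (gtn_eqF sp).
have [|ws [pws sws ws0]] :=
    Rolle_path (is_derive_twisted v ((v, p) :: l)) szs.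
  by move=> z /F0 ->; rewrite mulr0.
have sl : \sum_(a <- twisted_deriv v l) size a.2 = \sum_(a <- l) size a.2.
  rewrite big_map; apply: eq_big_seq => -[u r] url /=.
  rewrite size_deriv_add_scale// subr_eq0; apply: contraNneq vl => <-.
  by apply/mapP; exists (u, r).
have ps : (size (p^`() + (v - v) *: p)%R < size p)%N.
  by rewrite subrr scale0r addr0 lt_size_deriv.
have Z : {in twisted_deriv v ((v, p) :: l), forall a, a.2 = 0}.
  apply: (IH _ ws) => //=; rewrite ?big_cons /= ?sl ?size_map ?sws.
  - apply: leq_trans len; rewrite ltn_add2l ltn_add2r; exact: ps.
  - rewrite /unzip1 /twisted_deriv -map_comp.
    rewrite (map_comp (fun u => u - v) fst) map_inj_uniq; last exact: addIr.
    by rewrite (mem_map (@addIr _ _)) vl.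
  - by move: pws; case: (ws) => //= ? ? /andP[].
  - by rewrite -ltnS; apply: leq_trans lez; rewrite ltn_add2r; exact: ps.
have Zl b : b \in l -> b.2 = 0.
  move=> bl; apply/eqP; rewrite -size_poly_eq0.
  rewrite -(@size_deriv_add_scale _ b.2 (b.1 - v)).
    have /= -> := Z (b.1 - v, b.2^`() + (b.1 - v) *: b.2).
      by rewrite size_poly0.
    by rewrite inE; apply/orP; right; apply/mapP; exists b.
  rewrite subr_eq0; apply: contraNneq vl => <-; exact: map_f.
rewrite inE => /predU1P[->|/Zl//] /=; apply/eqP.
(* All the other terms vanish and [p] is constant: one zero suffices. *)
have dp : p^`() = 0.
  have := Z (v - v, p^`() + (v - v) *: p) (mem_head _ _).
  by rewrite /= subrr scale0r addr0.
have pC : p = (p`_0)%:P.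
  apply/size1_polyC/leq_sizeP => -[//|i] _; apply/eqP.
  have /eqP := congr1 (fun r : {poly R} => r`_i) dp.
  by rewrite coef_deriv coef0 mulrn_eq0.
have := F0 z0 (mem_head _ _).
rewrite /exp_poly big_cons big1_seq => [|b /andP[_ /Zl ->]]; last first.
  by rewrite horner0 mul0r.
rewrite addr0 /= {1}pC hornerC => /eqP.
by rewrite mulf_eq0 expR_eq0 orbF {2}pC polyC_eq0.
Qed.

(** * Liouville's inequality for integer polynomials *)

Lemma normr_det_le (K : numDomainType) (m : nat) (M : 'M[K]_m) (E : K) :
  (forall i j, `|M i j| <= E) -> `|\det M| <= m`!%:R * E ^+ m.
Proof.
move=> ME; apply: le_trans (ler_norm_sum _ _ _) _.
have -> : m`!%:R * E ^+ m = \sum_(s : 'S_m) E ^+ m.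
  by rewrite sumr_const card_Sn mulr_natl.
apply: ler_sum => s _; rewrite normrM normr_sign mul1r normr_prod.
have -> : E ^+ m = \prod_(i < m) E by rewrite prodr_const card_ord.
by apply: ler_prod => i _; rewrite normr_ge0 ME.
Qed.

Lemma normr_mxX_le (K : numDomainType) (n : nat) (M : 'M[K]_n.+1) (a : K) :
  (forall i j, `|M i j| <= a) ->
  forall k i j, `|(M ^+ k) i j| <= (n.+1%:R * a) ^+ k.
Proof.
move=> Ma; have a0 : 0 <= a by apply: le_trans (Ma ord0 ord0).
elim=> [|k IH] i j; first by rewrite !expr0 mxE normr_nat lern1 leq_b1.
rewrite exprS mxE; apply: le_trans (ler_norm_sum _ _ _) _.
rewrite exprS -mulrA mulr_natl -[X in _ *+ X]card_ord -sumr_const.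
by apply: ler_sum => l _; rewrite normrM ler_pM.
Qed.

Lemma mul_eigenvector_horner_mx (K : fieldType) (n : nat) (A : 'M[K]_n.+1)
    (a : K) (v : 'rV[K]_n.+1) (p : {poly K}) :
  v *m A = a *: v -> v *m horner_mx A p = p.[a] *: v.
Proof.
move=> vA; elim/poly_ind: p => [|p c IH].
  by rewrite rmorph0 horner0 mulmx0 scale0r.
rewrite rmorphD rmorphM /= horner_mx_X horner_mx_C hornerMXaddC mulmxDr.
by rewrite mulmxA IH -scalemxAl vA scalerA mul_mx_scalar scalerDl.
Qed.

Lemma ex_mx_char_poly (K : comNzRingType) (n : nat) (p : {poly K}) :
  p \is monic -> size p = n.+2 -> exists A : 'M[K]_n.+1, char_poly A = p.
Proof.
move=> /companionmxK; move: (companionmx p) => A Ap sp.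
by move: A Ap; rewrite sp /= => A; exists A.
Qed.

(** Such a [p] is an annihilator of [x] of least degree: [x] is not a root of
    [gcdp P p], hence it is a root of the cofactor of [gcdp P p] in [p], and by
    minimality this cofactor has the degree of [p]. *)
Lemma ex_minimal_poly (F K : fieldType) (f : {rmorphism F -> K}) (x : K) :
  algebraicOver f x ->
  exists p : {poly F}, [/\ p \is monic, root (map_poly f p) x &
    forall P : {poly F}, ~~ root (map_poly f P) x -> coprimep P p].
Proof.
move=> [p0 p0_neq0 rp0].
pose ann n := `[< exists p : {poly F},
  [/\ p != 0, root (map_poly f p) x & size p = n] >].
have : exists n, ann n by exists (size p0); apply/asboolP; exists p0.
move=> /ex_minnP[n /asboolP[p [pn0 rp sp]] minp].
exists ((lead_coef p)^-1 *: p); split.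
- by rewrite monicE lead_coefZ mulVf// lead_coef_eq0.
- by rewrite map_polyZ rootE hornerZ (rootP rp) mulr0.
move=> P nrP; rewrite coprimepZr ?invr_eq0 ?lead_coef_eq0//.
have /dvdpP[h ph] := dvdp_gcdr P p; set g := gcdp P p in ph.
have gn0 : g != 0 by rewrite gcdp_eq0 (negbTE pn0) andbF.
have hn0 : h != 0 by apply: contraNneq pn0 => h0; rewrite ph h0 mul0r.
have nrg : ~~ root (map_poly f g) x.
  apply: contra nrP; have /dvdpP[k Pk] := dvdp_gcdl P p.
  by rewrite Pk rmorphM rootM => ->; rewrite orbT.
have rh : root (map_poly f h) x.
  by move: rp; rewrite ph rmorphM rootM (negbTE nrg) orbF.
have : (size (h * g)%R <= size h)%N.
  by rewrite -ph sp; apply: minp; apply/asboolP; exists h.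
rewrite coprimep_def -/g size_mul//.
have := size_poly_gt0 g; have := size_poly_gt0 h; rewrite gn0 hn0.
case: (size h) (size g) => [|a] [|b] //= _ _.
by rewrite addnS ltnS -{2}[a]addn0 leq_add2l leqn0.
Qed.

Lemma ex_clear_denominators (m n : nat) (A : 'M[rat]_(m, n)) :
  exists2 D : nat, (0 < D)%N &
    exists B : 'M[int]_(m, n), map_mx intr B = D%:R *: A.
Proof.
pose D := (\prod_(ij : 'I_m * 'I_n) `|denq (A ij.1 ij.2)|)%N.
exists D; first by rewrite prodn_gt0// => ij; rewrite absz_gt0 denq_neq0.
exists (\matrix_(i, j) Num.floor (D%:R * A i j)); apply/matrixP => i j.
rewrite !mxE; apply: floorK.
rewrite /D (bigD1 (i, j)) //= mulnC natrM -mulrA rpredM ?rpred_nat//.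
rewrite -[X in _ * X]divq_num_den mulrCA natr_absz ger0_norm ?ltW ?denq_gt0//.
by rewrite divff ?mulr1 ?intr_int// intr_eq0 denq_neq0.
Qed.

Lemma ex_nat_ge (R : realType) (r : R) : exists2 n : nat, (0 < n)%N & r <= n%:R.
Proof.
by exists (Num.truncn r).+1; rewrite // ltW// truncnS_gt.
Qed.

(** The norm of [P(x)] is a nonzero rational number with controlled
    denominator, and it is realized here as a determinant. Let [A] be a rational
    matrix whose characteristic polynomial [p] is the minimal polynomial of [x],
    and [B = D A] integral. The integer matrix [Q = D ^ e P(A)] is invertible
    because [P] is coprime to [p], so [det Q] has absolute value at least one.
    If [v A = x v], then [v Q = D ^ e P(x) v], and multiplying by the adjugate
    of [Q] gives [det Q * v = D ^ e P(x) * (v * adj Q)], where the entries of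
    [adj Q] are bounded in terms of the coefficients of [P]. *)
Lemma liouville_inequality (R : realType) (x : R) :
  algebraicOver (ratr : rat -> R) x ->
  exists d C : nat, [/\ (0 < d)%N, (0 < C)%N &
    forall (P : {poly int}) (e l : nat), (size P <= e.+1)%N ->
      \sum_(k < e.+1) `|P`_k| <= l%:R ->
      (map_poly intr P).[x] != 0 ->
      1 <= `|(map_poly intr P).[x]| * C%:R ^+ e.+1 * l%:R ^+ d].
Proof.
move=> /ex_minimal_poly[p [pm rp cop]].
have [n sp] : exists n, size p = n.+2.
  case E: (size p) => [|[|n]]; last by exists n.
    by move/eqP: E; rewrite size_poly_eq0 (negbTE (monic_neq0 pm)).
  have [c c0 pc] := size_poly1P _ (introT eqP E).
  by move: rp; rewrite pc map_polyC rootC fmorph_eq0 (negbTE c0).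
have [A Ap] := ex_mx_char_poly pm sp.
have [v vA vn0] : exists2 v : 'rV[R]_n.+1,
    v *m map_mx ratr A = x *: v & v != 0.
  by apply/eigenvalueP; rewrite eigenvalue_root_char -map_char_poly Ap.
have [D D0 [B BA]] := ex_clear_denominators A.
have [i0 vi0] : exists i, v 0 i != 0 by apply/rV0Pn.
pose a := (\sum_i \sum_j `|B i j|)%N.
have Ba i j : `|B i j| <= a%:R.
  rewrite natz -abszE lez_nat /a (bigD1 i) //= (bigD1 j) //=.
  by rewrite -addnA leq_addr.
pose V := \sum_j `|v 0 j|.
have [c c0 cV] := ex_nat_ge (V * n`!%:R / `|v 0 i0|).
(* [E] is at least [D] and at least [(n + 1) a], the growth rate of [B ^ k]. *)
pose E := (D * (n.+1 * a).+1)%N.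
exists n.+1, (c * (D ^ n.+1 * E ^ n))%N; split=> // [|P e l sP lP Px].
  by rewrite !muln_gt0 !expn_gt0 /E D0 c0 /= muln_gt0 D0.
pose Q := \sum_(k < e.+1) (P`_k * D%:R ^+ (e - k)) *: B ^+ k.
have QA : map_mx intr Q = D%:R ^+ e *: horner_mx A (map_poly intr P).
  have -> : map_poly intr P = \poly_(k < e.+1) (P`_k)%:~R :> {poly rat}.
    apply/polyP => k; rewrite coef_map coef_poly /=.
    by case: ltnP => // ek; rewrite nth_default// (leq_trans sP).
  rewrite poly_def raddf_sum linear_sum scaler_sumr; apply: eq_bigr => k _ /=.
  rewrite map_mxZ rmorphM !rmorphXn rmorph_nat /= BA exprZn.
  rewrite [horner_mx _ _]linearZ /= rmorphXn /= horner_mx_X !scalerA.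
  congr (_ *: _).
  by rewrite -mulrA mulrC -exprD subnK// -ltnS.
have QE i j : `|Q i j| <= l%:R * E%:R ^+ e.
  rewrite summxE; apply: le_trans (ler_norm_sum _ _ _) _.
  apply: (@le_trans _ _ (\sum_(k < e.+1) `|P`_k| * E%:R ^+ e)); last first.
    by rewrite -mulr_suml ler_wpM2r.
  apply: ler_sum => k _; rewrite mxE !normrM -mulrA ler_wpM2l//.
  have ke : (k <= e)%N by rewrite -ltnS.
  have -> : E%:R ^+ e = E%:R ^+ (e - k) * E%:R ^+ k :> int.
    by rewrite -exprD subnK.
  rewrite normrX normr_nat ler_pM ?exprn_ge0//.
    by rewrite lerXn2r ?nnegrE// ler_nat /E leq_pmulr.
  apply: (le_trans (normr_mxX_le Ba _ _ _)).
  rewrite lerXn2r ?nnegrE ?mulr_ge0// -natrM ler_nat /E.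
  by apply: leq_trans (leqnSn _) _; rewrite leq_pmull.
have detQ : \det Q != 0.
  rewrite -(@intr_eq0 rat) -det_map_mx QA detZ mulf_neq0 ?expf_neq0//.
    by rewrite pnatr_eq0 -lt0n.
  have /Bezout_eq1_coprimepP[[u w] /= uw] : coprimep (map_poly intr P) p.
    apply: cop; rewrite -map_poly_comp rootE.
    by rewrite (eq_map_poly (g := intr))// => z /=; rewrite ratr_int.
  have Ap0 : horner_mx A p = 0 by rewrite -Ap Cayley_Hamilton.
  have /(congr1 (horner_mx A)) := uw.
  rewrite rmorphD !rmorphM rmorph1 /= Ap0 mulr0 addr0.
  by move=> /mulmx1_unit[_]; rewrite unitmxE unitfE.
have vQ : v *m map_mx intr Q = (D%:R ^+ e * (map_poly intr P).[x]) *: v.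
  have -> : map_mx intr Q = map_mx ratr (map_mx intr Q) :> 'M[R]_n.+1.
    by rewrite -map_mx_comp; apply: eq_map_mx => z /=; rewrite ratr_int.
  rewrite QA map_mxZ rmorphXn /= ratr_nat map_horner_mx -scalemxAr.
  rewrite (mul_eigenvector_horner_mx _ vA) scalerA -map_poly_comp.
  by rewrite (eq_map_poly (g := intr))// => z /=; rewrite ratr_int.
have adjQ j : `|(\adj Q) j i0| <= n`!%:R * (l%:R * E%:R ^+ e) ^+ n.
  rewrite mxE /cofactor normrM normrX normrN1 expr1n mul1r.
  by apply: normr_det_le => i k; rewrite !mxE.
have l0 : (0 < l)%N.
  rewrite lt0n; apply: contraNneq Px => l0; move: lP; rewrite l0 => lP.
  suff -> : P = 0 by rewrite rmorph0 horner0.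
  apply/polyP => k; rewrite coef0; case: (ltnP k e.+1) => ke; last first.
    by rewrite nth_default// (leq_trans sP).
  apply/eqP; rewrite -normr_le0; apply: le_trans lP.
  by rewrite (bigD1 (Ordinal ke)) //= lerDl sumr_ge0.
have key : `|v 0 i0| <= D%:R ^+ e * `|(map_poly intr P).[x]| *
    (V * (n`!%:R * (l%:R * E%:R ^+ e) ^+ n)).
  have det1 : 1 <= `|(\det Q)%:~R| :> R.
    by rewrite -intr_norm ler1z -gtz0_ge1 normr_gt0.
  have detv : (\det Q)%:~R * v 0 i0 =
      D%:R ^+ e * (map_poly intr P).[x] * \sum_j v 0 j * (\adj Q j i0)%:~R.
    have /(congr1 (fun M => (M *m \adj (map_mx intr Q)) 0 i0)) := vQ.
    rewrite -mulmxA mul_mx_adj det_map_mx mul_mx_scalar mxE => ->.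
    rewrite -scalemxAl mxE mxE -map_mx_adj; congr (_ * _).
    by apply: eq_bigr => j _; rewrite [in LHS]mxE.
  apply: (@le_trans _ _ (`|(\det Q)%:~R * v 0 i0|)).
    by rewrite normrM ler_peMl.
  rewrite detv !normrM normrX normr_nat ler_wpM2l ?mulr_ge0 ?exprn_ge0//.
  apply: le_trans (ler_norm_sum _ _ _) _.
  rewrite /V mulr_suml; apply: ler_sum => j _.
  rewrite normrM ler_wpM2l// -intr_norm.
  have := adjQ j; rewrite -(ler_int R) => /le_trans; apply.
  by rewrite rmorphM rmorph_nat rmorphXn rmorphM rmorph_nat rmorphXn rmorph_nat.
have v0 : 0 < `|v 0 i0| by rewrite normr_gt0.
have {}key : 1 <= `|(map_poly intr P).[x]| *
    (c * (D ^ e * E ^ (e * n)) * l ^ n)%:R.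
  rewrite -(ler_pM2l v0) mulr1; apply: (le_trans key).
  move: cV; rewrite ler_pdivrMr// => cV.
  rewrite (natrM _ (c * _)) (natrM _ c) (natrM _ (D ^ e)) !natrX !exprMn -exprM.
  set X := `|_.[x]|; set d := D%:R ^+ e; set m := E%:R ^+ _; set k := l%:R ^+ n.
  have -> : d * X * (V * (n`!%:R * (k * m))) = V * n`!%:R * (X * d * m * k).
    by ring.
  have -> : `|v 0 i0| * (X * (c%:R * (d * m) * k)) =
    c%:R * `|v 0 i0| * (X * d * m * k) by ring.
  by rewrite ler_wpM2r// /X /d /m /k !mulr_ge0 ?exprn_ge0.
apply: (le_trans key); rewrite -mulrA ler_wpM2l// -!natrX -natrM ler_nat.
have E0 : (0 < E)%N by rewrite muln_gt0 D0.
clearbody E.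
rewrite leq_mul ?leq_pexp2l// !expnMn leq_mul//.
  by rewrite -{1}[c]expn1 leq_pexp2l.
rewrite -!expnM leq_mul// leq_pexp2l//.
  by rewrite (leq_trans (leqnSn e))// leq_pmull.
by rewrite mulnC leq_mul2l leqnSn orbT.
Qed.

(** * Taylor expansion and the pigeonhole principle *)

Lemma expR_series_le (R : realType) (u : R) (n : nat) :
  0 <= u -> \sum_(m < n) u ^+ m / m`!%:R <= expR u.
Proof.
move=> u0.
have nd : nondecreasing_seq (series (exp_coeff u)).
  by apply: nondecreasing_series => i _ _; exact: exp_coeff_ge0.
have := nondecreasing_cvgn_le nd (is_cvg_series_exp_coeff u) n.
by rewrite /series /= big_mkord.
Qed.

(** For [m >= M] the [m]-th term of the series of [expR u] is at most
    [r ^- M] times that of [expR (r * u)]. *)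
Lemma expR_series_tail (R : realType) (u r : R) (M : nat) :
  0 <= u -> 1 <= r ->
  `|expR u - \sum_(m < M) u ^+ m / m`!%:R| <= expR (r * u) / r ^+ M.
Proof.
move=> u0 r1; have r0 : 0 < r by apply: lt_le_trans r1.
rewrite ger0_norm ?subr_ge0 ?expR_series_le// lerBlDr.
apply: limr_le; first exact: is_cvg_series_exp_coeff.
exists M => // n /= Mn; rewrite /series /= big_mkord.
apply: (@le_trans _ _ (\sum_(m < n) ((r * u) ^+ m / m`!%:R / r ^+ M +
    (if (m < M)%N then u ^+ m / m`!%:R else 0)))).
  apply: ler_sum => m _; rewrite /exp_coeff /=; case: ltnP => mM.
    by rewrite lerDr !mulr_ge0 ?invr_ge0 ?exprn_ge0 ?mulr_ge0 // ltW.
  rewrite addr0 mulrAC ler_wpM2r ?invr_ge0//.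
  rewrite exprMn ler_pdivlMr ?exprn_gt0// mulrC ler_wpM2r ?exprn_ge0//.
  by rewrite ler_weXn2l.
rewrite big_split /= lerD//.
  rewrite -mulr_suml ler_wpM2r ?invr_ge0 ?exprn_ge0 ?(ltW r0)//.
  by rewrite expR_series_le// mulr_ge0// ltW.
by rewrite -big_mkcond /= [leRHS](big_ord_widen n (fun m => u ^+ m / m`!%:R)).
Qed.

(** The coefficient of [z ^ k] in the Taylor expansion of
    [z ^ s * expR (v * z)]. *)
Definition taylor_coef (R : realType) (s : nat) (v : R) (k : nat) : R :=
  if (s <= k)%N then v ^+ (k - s) / (k - s)`!%:R else 0.

Lemma taylor_coef_ge0 (R : realType) s (v : R) k :
  0 <= v -> 0 <= taylor_coef s v k.
Proof.
by move=> v0; rewrite /taylor_coef; case: ifP => // _; rewrite mulr_ge0 ?exprn_ge0.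
Qed.

Lemma taylor_coef_le (R : realType) s (v X : R) k :
  0 <= v -> 0 <= X -> taylor_coef s v k * X ^+ k <= X ^+ s * expR (v * X).
Proof.
move=> v0 X0; rewrite /taylor_coef; case: leqP => sk; last first.
  by rewrite mul0r mulr_ge0 ?exprn_ge0 ?expR_ge0.
rewrite -{3}(subnK sk) exprD mulrA mulrC ler_wpM2l ?exprn_ge0//.
rewrite mulrAC -exprMn.
apply: le_trans (expR_series_le (k - s).+1 (mulr_ge0 v0 X0)).
rewrite big_ord_recr /= lerDr sumr_ge0// => i _.
by rewrite mulr_ge0 ?exprn_ge0 ?mulr_ge0.
Qed.

(** The dilation factor [r] plays the part of the ratio of radii in Cauchy's
    estimates: the remainder gains [r ^- K] over the value at [r * z]. *)
Lemma taylor_remainder (R : realType) (s K : nat) (v z r : R) :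
  (s <= K)%N -> 0 <= v -> 0 <= z -> 1 <= r ->
  `|z ^+ s * expR (v * z) - \sum_(k < K) taylor_coef s v k * z ^+ k| <=
    (r * z) ^+ s * expR (v * (r * z)) / r ^+ K.
Proof.
move=> sK v0 z0 r1; have r0 : 0 < r by apply: lt_le_trans r1.
have -> : \sum_(k < K) taylor_coef s v k * z ^+ k =
    z ^+ s * \sum_(m < K - s) (v * z) ^+ m / m`!%:R.
  rewrite -(big_mkord xpredT (fun k => taylor_coef s v k * z ^+ k)).
  rewrite (big_cat_nat (n := s))//= big_nat_cond big1 ?add0r; last first.
    by move=> i /andP[/andP[_ ilt] _]; rewrite /taylor_coef leqNgt ilt mul0r.
  rewrite -{1}[s]add0n big_addn big_mkord mulr_sumr; apply: eq_bigr => i _.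
  rewrite /taylor_coef leq_addl addnK exprD exprMn; ring.
rewrite -mulrBr normrM ger0_norm ?exprn_ge0//.
apply: (le_trans (ler_wpM2l _ (expR_series_tail (K - s) _ r1))).
- by rewrite exprn_ge0.
- by rewrite mulr_ge0.
rewrite -{2}(subnK sK) exprD exprMn (mulrCA v r).
have rs : r ^+ s != 0 by rewrite expf_neq0// gt_eqF.
have rKs : r ^+ (K - s) != 0 by rewrite expf_neq0// gt_eqF.
by rewrite le_eqVlt; apply/orP; left; apply/eqP; field; rewrite rs rKs.
Qed.

(** The values of the [K] forms at the vectors with coordinates in [0, H) lie in
    [0, H B). Cut this interval into [M] parts: two of the [H ^ #|I|] vectors
    share all of their [K] parts, and [c] is their difference. *)
Lemma pigeonhole_small_forms (R : realType) (I : finType) (K H M : nat)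
    (A : I -> nat -> R) (B : R) :
  0 < B -> (forall i k, 0 <= A i k) -> (forall k, \sum_i A i k <= B) ->
  (0 < M)%N -> (M ^ K < H ^ #|I|)%N ->
  exists c : I -> int, [/\ exists i, c i != 0, forall i, `|c i| <= H%:R &
    forall k, (k < K)%N -> `|\sum_i (c i)%:~R * A i k| <= H%:R * B / M%:R].
Proof.
move=> B0 A0 AB M0 MH.
case: M M0 MH => // M _ MH.
have H0 : (0 < H)%N.
  have := leq_ltn_trans (leq0n _) MH; rewrite expn_gt0 => /orP[//|/eqP I0].
  by move: MH; rewrite I0 expn0 ltnS leqn0 expn_eq0.
pose L (c : {ffun I -> 'I_H}) k : R := \sum_i (c i)%:R * A i k.
have MHB : 0 < M.+1%:R / (H%:R * B) :> R.
  by rewrite divr_gt0// mulr_gt0// ltr0n.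
have L0 c k : 0 <= L c k by apply: sumr_ge0 => i _; rewrite mulr_ge0.
have LB c k : L c k < H%:R * B.
  have HE : (H.-1)%:R + 1 = H%:R :> R by rewrite natr1 prednK.
  rewrite -HE mulrDl mul1r ltr_pwDr//.
  apply: (@le_trans _ _ (\sum_i (H.-1)%:R * A i k)).
    by rewrite /L; apply: ler_sum => i _; rewrite ler_wpM2r// ler_nat -ltnS prednK.
  by rewrite -mulr_sumr ler_wpM2l.
pose box (c : {ffun I -> 'I_H}) : {ffun 'I_K -> 'I_M.+1} :=
  [ffun k : 'I_K => inord (Num.truncn (L c k * (M.+1%:R / (H%:R * B))))].
have /injectivePn[c [c' cc' bcc']] : ~~ injectiveb box.
  apply: contraL MH => /injectiveP /leq_card.
  by rewrite !card_ffun !card_ord -leqNgt.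
exists (fun i => (c i : int) - (c' i : int)); split.
- apply: contrapT => /forallNP nex; move: cc' => /eqP; apply.
  apply/ffunP => i; apply/val_inj => /=.
  by have /negP := nex i; rewrite negbK subr_eq0 => /eqP[->].
- by move=> i; have := ltn_ord (c i); have := ltn_ord (c' i); lia.
move=> k kK.
have -> : \sum_i ((c i : int) - (c' i : int))%:~R * A i k = L c k - L c' k.
  rewrite -sumrB; apply: eq_bigr => i _; by rewrite rmorphB mulrBl.
have := congr1 (fun b : {ffun 'I_K -> 'I_M.+1} => val (b (Ordinal kK))) bcc'.
set mu := M.+1%:R / (H%:R * B) in MHB *.
have Lmu b : 0 <= L b k * mu by rewrite mulr_ge0 ?L0// ltW.
have boxE b : val (box b (Ordinal kK)) = Num.truncn (L b k * mu).
  rewrite ffunE /= inordK// truncn_lt_nat ?Lmu//.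
  by rewrite /mu mulrA ltr_pdivrMr ?mulr_gt0 ?ltr0n// mulrC ltr_pM2l ?ltr0n.
rewrite /= !boxE => tE.
have -> : H%:R * B / M.+1%:R = mu^-1 by rewrite invf_div.
have /andP[l1 u1] := truncn_itv (Lmu c); have /andP[l2 u2] := truncn_itv (Lmu c').
rewrite -[_^-1]div1r ler_pdivlMr// -(gtr0_norm MHB) -normrM mulrBl.
by move: l1 u1 l2 u2; rewrite tE -natr1 ler_norml => *; apply/andP; split; lra.
Qed.

(** * Solutions of x ^ x = q *)

Lemma ex_powR_self (R : realType) (y : R) :
  1 < y -> exists2 x : R, 1 < x & x `^ x = y.
Proof.
move=> y1; have y0 : 0 < y by apply: lt_trans y1.
have cont : {within `[1, y], continuous (fun x : R => expR (x * ln x))}%classic.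
  apply: derivable_within_continuous => x; rewrite in_itv /= => /andP[x1 _].
  have x0 : 0 < x by apply: lt_le_trans x1.
  have dln := is_derive1_ln x0.
  have dm : derivable (fun x : R => x * ln x) x 1.
    by apply: derivableM; [exact: derivable_id | exact: ex_derive].
  apply/derivable1_diffP/differentiable_comp; first exact/derivable1_diffP.
  by apply/derivable1_diffP; exact: derivable_expR.
have powE (x : R) : 0 < x -> x `^ x = expR (x * ln x).
  by move=> x0; rewrite /powR gt_eqF.
have [|x] := IVT (v := y) (ltW y1) cont.
  rewrite ln1 mulr0 expR0 ge_min (ltW y1) le_max -powE//.
  by rewrite (le1r_powR (ltW y1) (ltW y1)) orbT.
rewrite in_itv /= le_eqVlt => /andP[/predU1P[<- _|x1 _ xy]].
  by rewrite ln1 mulr0 expR0 => y1'; move: y1; rewrite -y1' ltxx.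
by exists x => //; rewrite powE// (lt_trans _ x1).
Qed.

(** If a prime [p] divides the denominator [b] of [a / b], then comparing [p]-adic
    valuations in [(a / b) ^ a = (m / n) ^ b] shows that [b] divides
    [logn p b], which is positive and less than [b]. *)
Lemma denominator_eq1 (a b m n : nat) :
  (0 < a)%N -> (0 < b)%N -> (0 < m)%N -> (0 < n)%N -> coprime a b ->
  (m ^ b * b ^ a = a ^ a * n ^ b)%N -> b = 1%N.
Proof.
move=> a0 b0 m0 n0 ab eqn; apply/eqP; rewrite eqn_leq b0 andbT leqNgt.
apply/negP => b1; have pp := pdiv_prime b1; set p := pdiv b in pp.
have pb : (p %| b)%N := pdiv_dvd b.
have la : logn p a = 0%N.
  by rewrite lognE a0 pp /=; case: ifP => // pa; have := coprime_dvdl pa ab;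
    rewrite prime_coprime// pb.
have := congr1 (logn p) eqn.
rewrite !lognM ?expn_gt0 ?a0 ?b0 ?m0 ?n0// !lognX la muln0 add0n => e.
have : (b %| logn p b)%N.
  rewrite -(Gauss_dvdr (m := b) (n := a)) 1?coprime_sym//.
  by rewrite -(dvdn_addr _ (dvdn_mulr (logn p m) (dvdnn b))) e dvdn_mulr.
move/dvdn_leq; rewrite logn_gt0 mem_primes pp b0 pb /= => /(_ isT).
rewrite leqNgt => /negP; apply.
apply: leq_trans (ltn_expl _ (prime_gt1 pp)) _.
by rewrite dvdn_leq// pfactor_dvdnn.
Qed.

Lemma ex_nat_fraction (s : rat) : 0 < s -> exists a b : nat,
  [/\ (0 < a)%N, (0 < b)%N, coprime a b & s = a%:R / b%:R].
Proof.
move=> s0; exists `|numq s|%N, `|denq s|%N; split.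
- by rewrite absz_gt0 numq_eq0 gt_eqF.
- by rewrite absz_gt0 denq_neq0.
- exact: coprime_num_den.
- rewrite !natr_absz !gtr0_norm ?denq_gt0 ?numq_gt0//.
  by rewrite divq_num_den.
Qed.

Lemma rational_powR_self (R : realType) (r q : rat) :
  0 < r -> 0 < q -> (ratr r : R) `^ ratr r = ratr q ->
  exists n : nat, (0 < n)%N /\ n%:R ^+ n = q.
Proof.
move=> r0 q0 rq.
have [a [b [a0 b0 ab rE]]] := ex_nat_fraction r0.
have [m [n [m0 n0 _ qE]]] := ex_nat_fraction q0.
have b0' : b%:R != 0 :> rat by rewrite pnatr_eq0 -lt0n.
have n0' : n%:R != 0 :> rat by rewrite pnatr_eq0 -lt0n.
have R0 : 0 <= (ratr r : R) by rewrite ler0q ltW.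
have key : q ^+ b = r ^+ a.
  apply: (fmorph_inj (ratr : rat -> R)); rewrite !rmorphXn /= -rq.
  rewrite -powR_mulrn ?powR_ge0// -powRrM -powR_mulrn//; congr (_ `^ _).
  rewrite -(ratr_nat _ b) -rmorphM rE mulfVK//.
  by rewrite rmorph_nat.
have b1 : b = 1%N.
  apply: (@denominator_eq1 a b m n) => //; apply/eqP.
  rewrite -(eqr_nat rat) !natrM !natrX; apply/eqP; move: key.
  rewrite qE rE !expr_div_n => /(congr1 (fun z => z * (n%:R ^+ b * b%:R ^+ a))).
  rewrite mulrA divfK ?expf_neq0// => ->.
  by rewrite mulrCA divfK ?expf_neq0// mulrC.
exists a; split=> //.
by rewrite -[q]expr1 -{1}b1 key rE b1 divr1.
Qed.

(** * The auxiliary function *)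

Definition aux_fun (R : realType) (w : R) (S T : nat)
    (c : 'I_S * 'I_T -> int) (z : R) : R :=
  \sum_p (c p)%:~R * (z ^+ p.1 * expR (p.2%:R * w * z)).

(** Grouped by the exponent [t * w], [aux_fun w c] is an exponential polynomial
    with [T] terms and [S * T] coefficients. *)
Lemma aux_fun_eq0 (R : realType) (w : R) (S T : nat)
    (c : 'I_S * 'I_T -> int) (zs : seq R) :
  w != 0 -> uniq zs -> (S * T <= size zs)%N ->
  {in zs, forall z, aux_fun w c z = 0} -> forall p, c p = 0.
Proof.
move=> w0 uzs szs F0 [s t].
pose ps (t : 'I_T) : {poly R} :=
  \poly_(k < S) (if insub k is Some s then (c (s, t))%:~R else 0).
pose l := [seq (t%:R * w, ps t) | t : 'I_T].
have ps0 : ps t = 0.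
  apply: (@exp_poly_eq0 R l (sort <=%R zs) _ _ _ _ (t%:R * w, ps t)).
  - rewrite /unzip1 /l -map_comp map_inj_uniq ?enum_uniq// => i j /=.
    by move=> /(mulIf w0)/eqP; rewrite eqr_nat => /eqP /val_inj.
  - by rewrite sort_lt_sorted.
  - rewrite size_sort big_map big_enum /=; apply: leq_trans szs.
    rewrite mulnC -[X in (_ <= X * _)%N]card_ord -sum_nat_const.
    by apply: leq_sum => i _; exact: size_poly.
  - move=> z; rewrite mem_sort => /F0 <-.
    rewrite /exp_poly big_map big_enum /= /aux_fun.
    rewrite (eq_bigr (fun p => (fun s t => (c (s, t))%:~R *
      (z ^+ s * expR (t%:R * w * z))) p.1 p.2)); last by case.
    rewrite -(pair_bigA _ (fun s t => (c (s, t))%:~R *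
      (z ^+ s * expR (t%:R * w * z)))) /= exchange_big /=.
    apply: eq_bigr => i _; rewrite horner_poly mulr_suml.
    by apply: eq_bigr => k _; rewrite valK mulrA.
  - by apply/mapP; exists t; rewrite ?mem_enum.
have := congr1 (fun r : {poly R} => r`_s) ps0.
by rewrite coef_poly coef0 ltn_ord valK => /eqP; rewrite intr_eq0 => /eqP.
Qed.

(** The pigeonhole principle makes the first [K] Taylor coefficients of the
    function, scaled by powers of [X], small: they contribute the first term of
    the bound on [0, X]. The second term is the Taylor remainder, in which the
    dilation factor [r] is free. *)
Lemma ex_small_aux_fun (R : realType) (w : R) (S T K H M X r g : nat) :
  0 <= w -> expR w <= g%:R -> (S <= K)%N -> (0 < S)%N -> (0 < T)%N ->
  (0 < X)%N -> (0 < r)%N -> (0 < M)%N -> (M ^ K < H ^ (S * T))%N ->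
  exists c : 'I_S * 'I_T -> int,
    [/\ exists p, c p != 0, forall p, `|c p| <= H%:R &
      forall z : R, 0 <= z <= X%:R -> `|aux_fun w c z| <=
        (K * (H * (S * T * (X ^ S * g ^ (T * X)))))%:R / M%:R +
        (H * (S * T * ((r * X) ^ S * g ^ (T * (r * X)))))%:R / r%:R ^+ K].
Proof.
move=> w0 wg SK S0 T0 X0 r0 M0 MH.
have Sw (t : 'I_T) : 0 <= t%:R * w by rewrite mulr_ge0.
have g1 : 1 <= g%:R :> R.
  by apply: le_trans wg; rewrite -expR0 ler_expR.
have expX (t : 'I_T) (z : R) (Y : nat) : 0 <= z <= Y%:R ->
    expR (t%:R * w * z) <= (g ^ (T * Y))%:R.
  move=> /andP[z0 zY].
  apply: (@le_trans _ _ (expR (w * (T * Y)%:R))).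
    rewrite ler_expR mulrAC mulrC ler_wpM2l// natrM ler_pM//.
    by rewrite ler_nat ltnW.
  by rewrite expRM_natr natrX lerXn2r ?nnegrE ?expR_ge0// (le_trans _ g1).
have powX (s : 'I_S) (z : R) (Y : nat) : (0 < Y)%N -> 0 <= z <= Y%:R ->
    z ^+ s <= (Y ^ S)%:R.
  move=> Y0 /andP[z0 zY]; apply: (@le_trans _ _ (Y%:R ^+ s)).
    by rewrite lerXn2r ?nnegrE// (le_trans z0).
  by rewrite -natrX ler_nat leq_pexp2l// ltnW.
have cardST : #|{: 'I_S * 'I_T}| = (S * T)%N by rewrite card_prod !card_ord.
have sumST (a : R) : \sum_(p : 'I_S * 'I_T) a = (S * T)%:R * a.
  by rewrite sumr_const cardST mulr_natl.
have XX : 0 <= (X%:R : R) <= X%:R by rewrite ler0n lexx.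
pose A (p : 'I_S * 'I_T) k := taylor_coef p.1 (p.2%:R * w) k * X%:R ^+ k.
have [|p k|k|||c [c0 cH cA]] :=
  @pigeonhole_small_forms R _ K H M A (S * T * (X ^ S * g ^ (T * X)))%:R.
- rewrite ltr0n !muln_gt0 S0 T0 !expn_gt0 X0 /=.
  by have := lt_le_trans ltr01 g1; rewrite ltr0n => ->.
- by rewrite mulr_ge0 ?exprn_ge0 ?taylor_coef_ge0.
- rewrite natrM -sumST; apply: ler_sum => p _.
  apply: (le_trans (taylor_coef_le _ _ _ _)) => //.
  rewrite natrM ler_pM ?exprn_ge0 ?expR_ge0 ?powX//.
  exact: expX.
- by [].
- by rewrite cardST.
exists c; split=> // z /andP[z0 zX].
have X0R : 0 < X%:R :> R by rewrite ltr0n.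
have r1 : 1 <= r%:R :> R by rewrite ler1n.
have -> : aux_fun w c z =
    \sum_(k < K) (z / X%:R) ^+ k * \sum_p (c p)%:~R * A p k +
    \sum_p (c p)%:~R * (z ^+ p.1 * expR (p.2%:R * w * z) -
       \sum_(k < K) taylor_coef p.1 (p.2%:R * w) k * z ^+ k).
  have -> : \sum_(k < K) (z / X%:R) ^+ k * \sum_p (c p)%:~R * A p k =
      \sum_p (c p)%:~R * \sum_(k < K) taylor_coef p.1 (p.2%:R * w) k * z ^+ k.
    under eq_bigr do rewrite mulr_sumr.
    rewrite exchange_big; apply: eq_bigr => p _; rewrite mulr_sumr.
    apply: eq_bigr => k _; rewrite /A mulrCA expr_div_n; congr (_ * _).
    by rewrite mulrCA divfK// expf_neq0// gt_eqF.
  by rewrite -big_split; apply: eq_bigr => p _; rewrite /= -mulrDr addrC subrK.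
apply: le_trans (ler_normD _ _) (lerD _ _).
  apply: le_trans (ler_norm_sum _ _ _) _.
  have sumK (a : R) : K%:R * a = \sum_(k < K) a.
    by rewrite sumr_const card_ord mulr_natl.
  rewrite natrM -mulrA sumK; apply: ler_sum => k _.
  rewrite normrM -[leRHS]mul1r ler_pM//; last first.
    by rewrite natrM cA.
  rewrite ger0_norm ?exprn_ge0 ?divr_ge0//.
  by rewrite exprn_ile1 ?divr_ge0// ler_pdivrMr// mul1r.
apply: le_trans (ler_norm_sum _ _ _) _.
rewrite natrM -mulrA natrM -[_ / _]mulrA -sumST mulr_sumr.
apply: ler_sum => p _; rewrite normrM ler_pM//.
  by rewrite -intr_norm -[leRHS](rmorph_nat (intr : int -> R)) ler_int.
have psK : (p.1 <= K)%N by rewrite (leq_trans _ SK)// ltnW.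
apply: le_trans (taylor_remainder psK (Sw _) z0 r1) _.
have rz : 0 <= r%:R * z <= (r * X)%:R by rewrite mulr_ge0// natrM ler_wpM2l.
rewrite ler_wpM2r ?invr_ge0 ?exprn_ge0// natrM.
by rewrite ler_pM ?exprn_ge0 ?expR_ge0 ?powX ?expX ?muln_gt0 ?r0//; case/andP: rz.
Qed.

(** * Arithmetic of the values of the auxiliary function *)

Lemma leq_expn2 (m n e : nat) : (m <= n)%N -> (m ^ e <= n ^ e)%N.
Proof. by case: e => // e mn; rewrite leq_exp2r. Qed.

(** An integer polynomial whose value at [x] is the [p]-th term of the auxiliary
    function at [i + j x], once the denominator of [(a / b) ^ (p.2 * j)] is
    cleared; the common power [b ^ (T * N)] serves all [p] and all [j <= N]. *)
Definition aux_term (a b S T N i j : nat) (p : 'I_S * 'I_T) : {poly int} :=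
  ((i%:R + j%:R *: 'X) ^+ p.1 * 'X^(p.2 * i)) *+
    (a ^ (p.2 * j) * b ^ (T * N - p.2 * j)).

Lemma horner_aux_term (R : realType) (x : R) (a b S T N i j : nat)
    (p : 'I_S * 'I_T) :
  0 < x -> (0 < b)%N -> x `^ x = a%:R / b%:R -> (j <= N)%N ->
  (map_poly intr (aux_term a b N i j p)).[x] =
    b%:R ^+ (T * N) * ((i%:R + j%:R * x) ^+ p.1 *
                       expR (p.2%:R * ln x * (i%:R + j%:R * x))).
Proof.
move=> x0 b0 xx jN.
have b0' : b%:R != 0 :> R by rewrite pnatr_eq0 -lt0n.
have pjN : (p.2 * j <= T * N)%N by rewrite leq_mul// ltnW.
have -> : expR (p.2%:R * ln x * (i%:R + j%:R * x)) =
    x ^+ (p.2 * i) * (a%:R / b%:R) ^+ (p.2 * j).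
  rewrite -xx /powR (gt_eqF x0) -[in RHS]expRM_natl -{3}[x]lnK ?posrE//.
  rewrite -expRM_natl -expRD; congr expR; rewrite !natrM; ring.
rewrite /aux_term rmorphMn rmorphM !rmorphXn rmorphD rmorph_nat /=.
rewrite map_polyZ !map_polyX rmorph_nat hornerMn hornerM !horner_exp.
rewrite hornerD hornerZ hornerX -mulr_natr natrM !natrX.
have -> : (i%:R : {poly R}).[x] = i%:R by rewrite -polyC_natr hornerC.
rewrite expr_div_n -{2}(subnK pjN) exprD.
have bj : b%:R ^+ (p.2 * j) != 0 :> R by rewrite expf_neq0.
field; exact: bj.
Qed.

Lemma size_aux_term (a b S T N i j : nat) (p : 'I_S * 'I_T) :
  (i <= N)%N -> (size (aux_term a b N i j p) <= (S + T * N).+1)%N.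
Proof.
move=> iN; rewrite /aux_term -scaler_nat.
apply: leq_trans (size_scale_leq _ _) _.
apply: leq_trans (size_polyMleq _ _) _; rewrite size_polyXn addnS /=.
have s2 : (size (i%:R + j%:R *: 'X : {poly int})%R <= 2)%N.
  apply: leq_trans (size_polyD _ _) _; rewrite geq_max -polyC_natr.
  rewrite (leq_trans (size_polyC_leq1 _))//.
  by rewrite (leq_trans (size_scale_leq _ _))// size_polyX.
have s1 : (size ((i%:R + j%:R *: 'X : {poly int}) ^+ p.1)%R <= p.1.+1)%N.
  apply: leq_trans (size_poly_exp_leq _ _) _; rewrite ltnS.
  rewrite -[leqRHS]mul1n leq_mul2r; apply/orP; right.
  by case: (size _) s2 => [|[]].
apply: leq_trans (leq_add s1 (leqnn _)) _.
by rewrite addSn ltnS leq_add ?leq_mul// ltnW.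
Qed.

Lemma coef_aux_term_ge0 (a b S T N i j : nat) (p : 'I_S * 'I_T) k :
  0 <= (aux_term a b N i j p)`_k.
Proof.
have nnM (f g : {poly int}) : (forall k, 0 <= f`_k) -> (forall k, 0 <= g`_k) ->
    forall k, 0 <= (f * g)`_k.
  by move=> f0 g0 l; rewrite coefM sumr_ge0// => m _; rewrite mulr_ge0.
have nnX (f : {poly int}) n : (forall k, 0 <= f`_k) ->
    forall k, 0 <= (f ^+ n)`_k.
  move=> f0; elim: n => [|n IH] l; first by rewrite expr0 coef1; case: eqP.
  by rewrite exprS; exact: nnM.
rewrite coefMn mulrn_wge0//; apply: nnM => l; last by rewrite coefXn; case: eqP.
apply: nnX => m; rewrite coefD coefZ coefX -polyC_natr coefC.
by rewrite addr_ge0 ?mulr_ge0//; case: ifP.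
Qed.

(** The coefficients of each [aux_term] are nonnegative, so their sum is the
    value at [1]; this bounds the sum of the absolute values of the coefficients
    of the integer polynomial to which Liouville's inequality is applied. *)
Lemma aux_fun_liouville (R : realType) (x : R) (a b S T N H d C : nat)
    (c : 'I_S * 'I_T -> int) (i j : nat) :
  0 < x -> (0 < b)%N -> (b <= a)%N -> (0 < N)%N -> x `^ x = a%:R / b%:R ->
  (forall (P : {poly int}) (e l : nat), (size P <= e.+1)%N ->
      \sum_(k < e.+1) `|P`_k| <= l%:R ->
      (map_poly intr P).[x] != 0 ->
      1 <= `|(map_poly intr P).[x]| * C%:R ^+ e.+1 * l%:R ^+ d) ->
  (forall p, `|c p| <= H%:R) -> (i <= N)%N -> (j <= N)%N ->
  aux_fun (ln x) c (i%:R + j%:R * x) != 0 ->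
  1 <= (b ^ (T * N) * C ^ (S + T * N).+1 *
        (H * (S * T * ((2 * N) ^ S * a ^ (T * N)))) ^ d)%:R *
       `|aux_fun (ln x) c (i%:R + j%:R * x)|.
Proof.
move=> x0 b0 ba N0 xx liou cH iN jN F0.
pose P : {poly int} := \sum_p c p *: aux_term a b N i j p.
have Px : (map_poly intr P).[x] =
    b%:R ^+ (T * N) * aux_fun (ln x) c (i%:R + j%:R * x).
  rewrite raddf_sum horner_sum mulr_sumr; apply: eq_bigr => p _ /=.
  by rewrite map_polyZ hornerZ (horner_aux_term _ _ x0 b0 xx jN) mulrCA.
have b0' : b%:R != 0 :> R by rewrite pnatr_eq0 -lt0n.
have sP : (size P <= (S + T * N).+1)%N.
  apply: leq_trans (size_sum _ _ _) _; apply/bigmax_leqP => p _.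
  exact: leq_trans (size_scale_leq _ _) (size_aux_term _ _ _ _ iN).
have := liou P (S + T * N)%N (H * (S * T * ((2 * N) ^ S * a ^ (T * N))))%N sP.
rewrite Px normrM normrX normr_nat => L.
have {L} := L _ (mulf_neq0 (expf_neq0 _ b0') F0).
rewrite !(natrM, natrX) => L; apply: le_trans (L _) _; last first.
  by rewrite le_eqVlt; apply/orP; left; apply/eqP; ring.
apply: (@le_trans _ _ (\sum_p H%:R * (aux_term a b N i j p).[1])).
  apply: (@le_trans _ _ (\sum_(k < (S + T * N).+1)
      \sum_p H%:R * (aux_term a b N i j p)`_k)).
    apply: ler_sum => k _; rewrite coef_sum.
    apply: le_trans (ler_norm_sum _ _ _) _; apply: ler_sum => p _.
    rewrite coefZ normrM (ger0_norm (coef_aux_term_ge0 _ _ _ _ _ _ _)).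
    by rewrite ler_wpM2r ?coef_aux_term_ge0.
  rewrite exchange_big; apply: ler_sum => p _.
  rewrite (horner_coef_wide _ (size_aux_term _ _ _ _ iN)) mulr_sumr.
  by apply: ler_sum => k _; rewrite expr1n mulr1.
have -> : S%:R * T%:R * ((2%:R * N%:R) ^+ S * a%:R ^+ (T * N)) =
    \sum_(p : 'I_S * 'I_T) ((2 * N) ^ S * a ^ (T * N))%N%:R :> int.
  rewrite sumr_const card_prod !card_ord -[RHS]mulr_natl.
  by rewrite !(natrM, natrX).
rewrite mulr_sumr; apply: ler_sum => p _; rewrite ler_wpM2l//.
rewrite /aux_term hornerMn hornerM !horner_exp hornerD hornerZ hornerX.
rewrite -polyC_natr hornerC mulr1 expr1n mulr1 -natrD -natrX -mulr_natr -natrM.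
rewrite ler_nat leq_mul//.
  apply: (@leq_trans ((2 * N) ^ p.1)).
    by rewrite leq_expn2// mul2n -addnn leq_add.
  by rewrite leq_pexp2l ?muln_gt0// ltnW.
have pjN : (p.2 * j <= T * N)%N by rewrite leq_mul// ltnW.
by rewrite -{2}(subnKC pjN) expnD leq_mul2l leq_expn2// orbT.
Qed.

(** * Choice of parameters and conclusion *)

(** With [T] fixed and [n] large, all the quantities are compared with powers of
    [P = n ^ S], where [S = T n ^ 2], [N = T n] and [r = n]. Every factor other
    than [H], [M] and [r ^ K] is at most a small power of [P]: bases that do not
    depend on [n] are at most [n], and their exponents at most [2 S]. Taking
    [H = P ^ 8] gives [U <= P ^ (12 d + 3)], and both products on the left are at
    most [P ^ (12 d + 17)]. So [K = t S] with [t = 12 d + 17] handles the Taylor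
    remainder, as [r ^ K = P ^ t], and [M = H ^ (5 d)] the first Taylor
    coefficients. Then [T = 6 d t] leaves enough unknowns, [S T = 6 d K], for the
    pigeonhole principle. *)
Lemma ex_parameters (a b C d y g : nat) :
  (0 < d)%N -> (0 < y)%N -> (0 < g)%N ->
  exists S T N K H M r : nat, let X := (N * y)%N in
    let U := (b ^ (T * N) * C ^ (S + T * N).+1 *
              (H * (S * T * ((2 * N) ^ S * a ^ (T * N)))) ^ d)%N in
    [/\ [/\ (0 < S)%N, (0 < T)%N, (0 < N)%N, (0 < r)%N & (0 < M)%N],
        (S <= K)%N /\ (S * T <= N * N)%N, (M ^ K < H ^ (S * T))%N,
        (3 * (U * (K * (H * (S * T * (X ^ S * g ^ (T * X)))))) <= M)%N &
        (3 * (U * (H * (S * T * ((r * X) ^ S * g ^ (T * (r * X)))))) <= r ^ K)%N].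
Proof.
move=> d0 y0 g0.
have dd : (17 + 12 * d <= 8 * (5 * d))%N by lia.
pose t := (12 * d + 17)%N; pose T := (6 * d * t)%N.
have t0 : (0 < t)%N by rewrite /t addn_gt0 orbT.
have T0 : (0 < T)%N by rewrite !muln_gt0 d0.
pose n := (a + b + C + g ^ (T * y) + 2 * T + T * y + 3)%N.
have [an bn Cn gn] : [/\ a <= n, b <= n, C <= n & g ^ (T * y) <= n]%N.
  by rewrite /n; split; lia.
have [Tn Tyn n3] : [/\ 2 * T + 3 <= n, T * y <= n & 3 <= n]%N.
  by rewrite /n; split; lia.
have tT : (t <= T)%N by rewrite /T leq_pmull// muln_gt0 d0.
clearbody n.
pose S := (T * (n * n))%N; pose N := (T * n)%N.
have n0 : (0 < n)%N by lia.
have S4 : (4 <= S)%N by rewrite /S; nia.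
pose P := (n ^ S)%N.
have nX (e : nat) : (n ^ (S * e) = P ^ e)%N by rewrite expnM.
have P0 : (0 < P)%N by rewrite expn_gt0 n0.
have nle (m e : nat) : (m <= n)%N -> (e <= S)%N -> (m ^ e <= P)%N.
  by move=> mn eS; apply: leq_trans (leq_expn2 _ mn) _; rewrite leq_pexp2l.
have TNS : (T * N <= S)%N by rewrite /S leq_mul2l leq_mul2r; lia.
have e1 : (b ^ (T * N) <= P)%N by apply: nle.
have e5 : (a ^ (T * N) <= P)%N by apply: nle.
have e2 : (C ^ (S + T * N).+1 <= P ^ 2)%N.
  apply: leq_trans (leq_expn2 _ Cn) _; rewrite -nX leq_pexp2l//.
  by rewrite /S /N; nia.
have e3 : (S * T <= P)%N.
  apply: (@leq_trans (n ^ 4)); last by rewrite leq_pexp2l.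
  have -> : (S * T = (T * T) * (n * n))%N by rewrite /S; lia.
  have Tn' : (T <= n)%N by lia.
  by rewrite (expnD n 2 2) !mulnn leq_mul ?leq_expn2.
have e4 : ((2 * N) ^ S <= P ^ 2)%N.
  rewrite /P -expnM (mulnC S) expnM; apply: leq_expn2.
  by rewrite /N mulnA leq_mul//; lia.
have e6 : ((N * y) ^ S <= P ^ 2)%N.
  rewrite /P -expnM (mulnC S) expnM; apply: leq_expn2.
  by rewrite /N mulnAC leq_mul.
have e6' : ((n * (N * y)) ^ S <= P ^ 3)%N.
  by rewrite expnMn expnS leq_mul.
have e7 : (g ^ (T * (N * y)) <= P)%N.
  have -> : (T * (N * y) = T * y * (T * n))%N by rewrite /N; lia.
  by rewrite expnM; apply: nle => //; rewrite /S leq_mul2l leq_pmulr ?orbT.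
have e7' : (g ^ (T * (n * (N * y))) <= P)%N.
  have -> : (T * (n * (N * y)) = T * y * S)%N by rewrite /N /S; lia.
  by rewrite expnM; apply: nle.
have e8 : (t * S <= P)%N by rewrite mulnC; apply: leq_trans e3; rewrite leq_mul.
have e9 : (3 <= P)%N.
  by apply: leq_trans n3 _; rewrite -{1}[n]expn1 leq_pexp2l//; lia.
have N0 : (0 < N)%N by rewrite muln_gt0 T0.
have STN : (S * T <= N * N)%N by rewrite /S /N; lia.
have nK : (n ^ (t * S) = P ^ t)%N by rewrite mulnC nX.
have [TE tE] : T = (6 * d * t)%N /\ t = (12 * d + 17)%N by [].
(* Only these bounds matter below; unfolded, the powers are too large. *)
clearbody P; clearbody N S; clearbody T; clearbody t.
exists S, T, N, (t * S)%N, (P ^ 8)%N, ((P ^ 8) ^ (5 * d))%N, n => X U.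
have [e eE UP] : exists2 e, e = (3 + 12 * d)%N & (U <= P ^ e)%N.
  exists (3 + 12 * d)%N => //; rewrite expnD (expnM P 12) leq_mul//.
    by rewrite -[3%N]/(1 + 2)%N expnD leq_mul.
  apply: leq_expn2; rewrite -[12%N]/(8 + (1 + (2 + 1)))%N !expnD.
  by rewrite !leq_mul.
have S0 : (0 < S)%N by apply: leq_trans S4.
split.
- by split=> //; rewrite !expn_gt0 P0.
- by split=> //; rewrite leq_pmull.
- rewrite -expnM ltn_exp2l; last by rewrite -{1}(exp1n 8) ltn_exp2r// ltnW.
  have -> : (5 * d * (t * S) = 5 * (d * t * S))%N by rewrite !mulnA.
  have -> : (S * T = 6 * (d * t * S))%N by rewrite mulnC TE !mulnA.
  by rewrite ltn_pmul2r// !muln_gt0 d0 t0.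
- rewrite -expnM; apply: (@leq_trans (P ^ (17 + 12 * d))).
    have -> : (17 + 12 * d = 1 + (e + (1 + (8 + (1 + (2 + 1))))))%N.
      by rewrite eE; lia.
    by rewrite !(expnD P) expn1 !leq_mul.
  exact: leq_pexp2l P0 dd.
- have te : (t = 1 + (e + (8 + (1 + (3 + 1)))))%N by rewrite tE eE; lia.
  by rewrite nK te !(expnD P) expn1 !leq_mul.
Qed.

(** The Gelfond-Schneider theorem for a real number [x] raised to itself: the
    function of [ex_small_aux_fun] would vanish at all the points [i + j x]. *)
Lemma powR_self_neq_fraction (R : realType) (x : R) (a b : nat) :
  1 < x -> algebraicOver (ratr : rat -> R) x -> (forall r : rat, x != ratr r) ->
  (0 < b)%N -> (b <= a)%N -> x `^ x = a%:R / b%:R -> False.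
Proof.
move=> x1 algx irrx b0 ba xx; have x0 : 0 < x by apply: lt_trans x1.
have w0 : 0 < ln x by apply: ln_gt0.
have [d [C [d0 C0 liou]]] := liouville_inequality algx.
have [y y0 xy] := ex_nat_ge (1 + x).
have [g g0 wg] := ex_nat_ge (expR (ln x)).
have [S [T [N [K [H [M [r]]]]]]] := ex_parameters a b C d0 y0 g0.
set U := (_ * _ ^ d)%N => -[[S0 T0 N0 r0 M0] [SK STN] MH small1 small2].
have X0 : (0 < N * y)%N by rewrite muln_gt0 N0.
have [c [[p cp] cH Fsmall]] :=
  ex_small_aux_fun (ltW w0) wg SK S0 T0 X0 r0 M0 MH.
pose zs := [seq ij.1%:R + ij.2%:R * x | ij : 'I_N * 'I_N].
suff : c p = 0 by apply/eqP.
apply: (@aux_fun_eq0 R (ln x) S T c zs); first by rewrite gt_eqF.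
- rewrite map_inj_uniq ?enum_uniq// => -[i j] [i' j'] /= ij.
  have [jj|jj] := eqVneq j j'.
    move: ij; rewrite jj => /addIr/eqP; rewrite eqr_nat => /eqP /val_inj -> //.
  have jj' : j%:R - j'%:R != 0 :> R.
    by rewrite subr_eq0 eqr_nat.
  have /negP[] := irrx ((i'%:R - i%:R) / (j%:R - j'%:R)).
  rewrite fmorph_div !rmorphB !rmorph_nat; apply/eqP.
  apply: (mulIf jj'); rewrite divfK//; lra.
- by rewrite size_map -cardE card_prod !card_ord.
move=> z /mapP[[i j] _ ->] /=; apply: contrapT => /eqP F0.
have ij : 0 <= i%:R + j%:R * x <= (N * y)%:R.
  rewrite addr_ge0 ?mulr_ge0 ?(ltW x0)//= natrM.
  apply: (@le_trans _ _ (N%:R * (1 + x))); last by rewrite ler_wpM2l.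
  rewrite mulrDr mulr1 lerD ?ler_nat ?(ltnW (ltn_ord _))//.
  by rewrite ler_wpM2r ?(ltW x0)// ler_nat ltnW.
have := aux_fun_liouville x0 b0 ba N0 xx liou cH (ltnW (ltn_ord i))
  (ltnW (ltn_ord j)) F0.
rewrite -/U; apply/negP; rewrite -ltNge.
apply: le_lt_trans (ler_wpM2l _ (Fsmall _ ij)) _ => //.
rewrite mulrDr !mulrA -!natrM.
have M0' : 0 < M%:R :> R by rewrite ltr0n.
have r0' : 0 < r%:R ^+ K :> R by rewrite exprn_gt0// ltr0n.
apply: (@le_lt_trans _ _ (3^-1 + 3^-1)); last by lra.
rewrite lerD// ler_pdivrMr// mulrC ler_pdivlMr// mulrC -?natrX -natrM ler_nat.
  exact: small1.
exact: small2.
Qed.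

Theorem corollary2p3 (R : realType) (q : rat) (q_gt1 : 1 < q)
    (q_nsol : ~ exists n : nat, (0 < n)%N /\ n%:R ^+ n = q) :
  exists x : R, [/\ 0 < x, transcendental x & x `^ x = ratr q].
Proof.
have q0 : 0 < q by apply: lt_trans q_gt1.
have [x x1 xx] : exists2 x : R, 1 < x & x `^ x = ratr q.
  by apply: ex_powR_self; rewrite -(rmorph1 (ratr : rat -> R)) ltr_rat.
have x0 : 0 < x by apply: lt_trans x1.
exists x; split=> // algx.
have irrx r : x != ratr r.
  apply/eqP => xr; apply: q_nsol; apply: (@rational_powR_self R r q) => //.
    by rewrite -(ltr0q R) -xr.
  by rewrite -xr.
have [a [b [a0 b0 _ qE]]] := ex_nat_fraction q0.
apply: (powR_self_neq_fraction x1 algx irrx b0 (a := a)).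
  move: q_gt1; rewrite qE ltr_pdivlMr ?ltr0n// mul1r ltr_nat; exact: ltnW.
by rewrite xx qE fmorph_div !rmorph_nat.
Qed.
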